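(* Let $K_{m,n}$ be a complete bipartite graph with parts of cardinality $m$ and $n$, where $m$ is odd, $n$ is even, and $m>n \geq 2$. Then $EBI(K_{m,2}) = \{0\}$. For $n\geq 4$, let $q$ be the quotient when $m$ is divided by $\frac{n}{2}+1$ and let $r$ be the remainder (so $m = q(\frac{n}{2}+1)+r$ with $0 \le r < \frac{n}{2}+1$). Then \[ EBI(K_{m,n}) = \begin{cases} \{ 0,1, \dots, m+n-2q-2 \}, &\text{if } r = 0, \\ \{ 0,1, \dots, m+n-2q-3 \}, &\text{if } r = 1, \\ \{ 0,1, \dots, m+n-2q-4 \}, &\text{if } r \geq 2. \end{cases} \]
   Context: For a graph $G=(V,E)$, a binary edge-labeling is a surjection $f: E \to \{0,1\}$; an edge labeled $i$ is an $i$-edge, and $e(i)$ denotes the number of $i$-edges. The labeling is edge-friendly if $|e(1)-e(0)| \le 1$. For a vertex $v$, $\deg_i(v)$ is the number of $i$-edges incident with $v$. An edge-friendly labeling induces a partial vertex-labeling: $v$ is labeled $1$ if $\deg_1(v) > \deg_0(v)$, labeled $0$ if $\deg_0(v) > \deg_1(v)$, and unlabeled if $\deg_1(v)=\deg_0(v)$. Let $v(i)$ be the number of vertices labeled $i$. The edge-balanced index set is $EBI(G) = \{ |v(1)-v(0)| : f \text{ an edge-friendly labeling of } G\}$. *)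

(* Defs.v *)
From mathcomp Require Import all_boot all_order all_algebra.

Set Implicit Arguments.
Unset Strict Implicit.
Unset Printing Implicit Defensive.

Record graph := Graph {
  vertex :> finType;
  adj : rel vertex;
  adj_sym : symmetric adj;
  adj_irrefl : irreflexive adj
}.

Definition edges (G : graph) : {set {set G}} :=
  [set [set p.1; p.2] | p : G * G & adj p.1 p.2].

Definition edge (G : graph) : finType := {e : {set G} | e \in edges G}.

Section EdgeLabeling.
Variables (G : graph) (f : {ffun edge G -> bool}).

Definition edge_count (i : bool) : nat := #|[set e : edge G | f e == i]|.

Definition surjective_labeling : bool := [forall i, exists e, f e == i].

(* The difference inside `|_ - _|%N is taken in int, so it is not truncated. *)
Definition edge_friendly : bool :=
  surjective_labeling && (`|edge_count true - edge_count false|%N <= 1).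

Definition deg (i : bool) (v : G) : nat :=
  #|[set e : edge G | (v \in sval e) && (f e == i)]|.

Definition vertex_label (v : G) : option bool :=
  if deg false v < deg true v then Some true
  else if deg true v < deg false v then Some false
  else None.

Definition vertex_count (i : bool) : nat :=
  #|[set v | vertex_label v == Some i]|.

End EdgeLabeling.

Definition EBI (G : graph) : pred nat :=
  [pred k | [exists f : {ffun edge G -> bool},
     edge_friendly f &&
     (k == `|vertex_count f true - vertex_count f false|%N)]].

Section CompleteBipartite.
Variables m n : nat.

Definition cb_adj : rel ('I_m + 'I_n)%type := fun x y =>
  match x, y with
  | inl _, inr _ | inr _, inl _ => true
  | _, _ => false
  end.

Lemma cb_adj_sym : symmetric cb_adj.
Proof. by case=> ? [?|?]. Qed.

Lemma cb_adj_irrefl : irreflexive cb_adj.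
Proof. by case. Qed.

Definition complete_bipartite : graph := Graph cb_adj_sym cb_adj_irrefl.

End CompleteBipartite.

(* Main.v *)
(** A labeling of K_{m,n} is an m x n binary matrix; write h = n / 2, and
    m = q (h + 1) + r with r <= h.  Since mn is even, friendliness forces exactly
    m h ones.

    Upper bound: if p rows have more than h ones and z rows fewer, the deviations
    from h cancel and each is at least -h, so p <= h z; with p + z <= m this gives
    p - z <= q (h - 1) + max(r - 2, 0).  Columns have odd length, hence are all
    labeled, and they cannot all have a majority of ones, so they contribute at
    most n - 2.

    Attainment: z rows below h, p = z + d rows equal to h + 1 and the others equal
    to h realize every row difference d up to the bound.  Winding the rows
    cyclically around the n columns makes the column sums differ by at most one, so
    the columns contribute 0; reserving one column for (m + 1) / 2 - h ones and
    winding the rest around the other n - 1 columns makes them contribute n - 2.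
    As the row bound is at least n - 3, the two families cover every value. *)

Require Import Defs.
From mathcomp Require Import all_boot all_order all_algebra.
From mathcomp Require Import zify.

Set Implicit Arguments.
Unset Strict Implicit.
Unset Printing Implicit Defensive.

(** * Row and column counts of a binary matrix *)

Section LabelMatrix.
Variables (m n : nat) (M : 'I_m -> 'I_n -> bool).

Definition row_count (i : bool) (x : 'I_m) : nat := \sum_(y < n) (M x y == i).

Definition col_count (i : bool) (y : 'I_n) : nat := \sum_(x < m) (M x y == i).

Definition total_count (i : bool) : nat := \sum_(x < m) row_count i x.

Definition row_majority (i : bool) : nat :=
  \sum_(x < m) (row_count (~~ i) x < row_count i x).

Definition col_majority (i : bool) : nat :=
  \sum_(y < n) (col_count (~~ i) y < col_count i y).

Lemma row_countC i x : row_count (~~ i) x + row_count i x = n.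
Proof.
rewrite -big_split /= -[RHS]card_ord -sum1_card.
by apply: eq_bigr => y _; case: (M x y); case: i.
Qed.

Lemma col_countC i y : col_count (~~ i) y + col_count i y = m.
Proof.
rewrite -big_split /= -[RHS]card_ord -sum1_card.
by apply: eq_bigr => x _; case: (M x y); case: i.
Qed.

Lemma total_countE i : total_count i = \sum_(y < n) col_count i y.
Proof. exact: exchange_big. Qed.

Lemma total_countC i : total_count (~~ i) + total_count i = m * n.
Proof.
rewrite -big_split /= (eq_bigr (fun=> n)) => [|x _]; last exact: row_countC.
by rewrite sum_nat_const card_ord.
Qed.

Lemma row_majorityD i : row_majority i + row_majority (~~ i) <= m.
Proof.
rewrite -big_split -[leqRHS]card_ord -sum1_card; apply: leq_sum => x _ /=.
by rewrite negbK; case: ltngtP.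
Qed.

Lemma col_majorityD i : odd m -> col_majority i + col_majority (~~ i) = n.
Proof.
move=> m_odd; rewrite -big_split -[RHS]card_ord -sum1_card.
apply: eq_bigr => y _ /=; have := col_countC i y; rewrite negbK; lia.
Qed.

End LabelMatrix.

(** * From edge labelings of the complete bipartite graph to matrices *)

Lemma vertex_label_eqE (G : graph) (f : {ffun edge G -> bool}) i v :
  (vertex_label f v == Some i) = (deg f (~~ i) v < deg f i v).
Proof. by rewrite /vertex_label; case: i => /=; case: ltngtP. Qed.

Section CompleteBipartiteEdges.
Variables m n : nat.
Local Notation K := (complete_bipartite m n).

Lemma cb_edge_subproof (p : 'I_m * 'I_n) :
  [set inl p.1; inr p.2] \in edges K.
Proof. by apply/imsetP; exists (inl p.1 : K, inr p.2 : K); rewrite ?inE. Qed.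

Definition cb_edge (p : 'I_m * 'I_n) : edge K :=
  exist _ [set inl p.1; inr p.2] (cb_edge_subproof p).

Lemma in_cb_edgel x p : (inl x \in sval (cb_edge p)) = (p.1 == x).
Proof. by rewrite !inE orbF eq_sym. Qed.

Lemma in_cb_edger y p : (inr y \in sval (cb_edge p)) = (p.2 == y).
Proof. by rewrite !inE /= eq_sym. Qed.

Lemma cb_edge_inj : injective cb_edge.
Proof.
move=> [x y] [x' y'] e.
have := in_cb_edgel x (x, y); rewrite e in_cb_edgel eqxx => /eqP /= ->.
by have := in_cb_edger y (x, y); rewrite e in_cb_edger eqxx => /eqP /= ->.
Qed.

Lemma cb_edge_surj e : exists p, e = cb_edge p.
Proof.
case: e => e /[dup] /imsetP[[[x|y] [x'|y']]]; rewrite inE //= => _ -> ein.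
  by exists (x, y'); apply: val_inj.
by exists (x', y); apply: val_inj; rewrite /= setUC.
Qed.

Lemma card_cb_edge (P : pred (edge K)) :
  #|[set e | P e]| = \sum_(x < m) \sum_(y < n) P (cb_edge (x, y)).
Proof.
have -> : [set e | P e] = cb_edge @: [set p | P (cb_edge p)].
  apply/setP => e; have [p ->] := cb_edge_surj e.
  by rewrite mem_imset ?inE //; apply: cb_edge_inj.
rewrite card_imset; last exact: cb_edge_inj.
rewrite -sum1_card pair_big /= [RHS]big_mkcond /= big_mkcond /=.
by apply: eq_bigr => -[x y] _; rewrite inE; case: (P _).
Qed.

Definition label_matrix (f : {ffun edge K -> bool}) x y := f (cb_edge (x, y)).

Lemma edge_count_cb f i : edge_count f i = total_count (label_matrix f) i.
Proof. exact: card_cb_edge. Qed.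

Lemma deg_cbl (f : {ffun edge K -> bool}) i x : deg f i (inl x) = row_count (label_matrix f) i x.
Proof.
rewrite /deg card_cb_edge exchange_big; apply: eq_bigr => y _.
rewrite (bigD1 x) // big1 => [|x' ne]; rewrite in_cb_edgel ?eqxx /= ?addn0 //.
by rewrite (negPf ne).
Qed.

Lemma deg_cbr (f : {ffun edge K -> bool}) i y : deg f i (inr y) = col_count (label_matrix f) i y.
Proof.
rewrite /deg card_cb_edge; apply: eq_bigr => x _.
rewrite (bigD1 y) // big1 => [|y' ne]; rewrite in_cb_edger ?eqxx /= ?addn0 //.
by rewrite (negPf ne).
Qed.

Lemma vertex_count_cb f i : vertex_count f i =
  row_majority (label_matrix f) i + col_majority (label_matrix f) i.
Proof.
rewrite /vertex_count -sum1_card big_mkcond big_sumType /=.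
congr (_ + _); apply: eq_bigr => v _; rewrite inE vertex_label_eqE.
  by rewrite !deg_cbl; case: leqP.
by rewrite !deg_cbr; case: leqP.
Qed.

(** As [m * n] is even, a difference of at most 1 between the label counts is 0; as it is positive,
    both labels then occur, which gives surjectivity. *)
Lemma EBI_cbP k : ~~ odd (m * n) -> 0 < m * n ->
  reflect (exists M : 'I_m -> 'I_n -> bool,
             total_count M true = total_count M false /\
             k = `|(row_majority M true + col_majority M true)
                   - (row_majority M false + col_majority M false)|%N)
          (k \in EBI K).
Proof.
move=> mn_even mn_gt0; rewrite inE; apply: (iffP existsP) => [[f]|[M [totM ->]]].
  rewrite !vertex_count_cb => /andP[/andP[_]].
  rewrite !edge_count_cb => fr /eqP ->; exists (label_matrix f); split=> //.
  have := total_countC (label_matrix f) true; move: fr mn_even => /=; lia.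
pose g p := [exists q : 'I_m * 'I_n, (p == cb_edge q) && M q.1 q.2].
pose f := [ffun p => g p].
have fE : label_matrix f =2 M.
  move=> x y; rewrite /label_matrix ffunE; apply/existsP/idP => [[[x' y']]|Mxy].
    by case/andP => /eqP /cb_edge_inj [-> ->].
  by exists (x, y); rewrite eqxx.
have rE i x : row_count (label_matrix f) i x = row_count M i x.
  by apply: eq_bigr => y _; rewrite fE.
have cE i y : col_count (label_matrix f) i y = col_count M i y.
  by apply: eq_bigr => x _; rewrite fE.
have tE i : edge_count f i = total_count M i.
  by rewrite edge_count_cb; apply: eq_bigr => x _; rewrite rE.
exists f; rewrite !vertex_count_cb.
have rmE i : row_majority (label_matrix f) i = row_majority M i.
  by apply: eq_bigr => x _; rewrite !rE.
have cmE i : col_majority (label_matrix f) i = col_majority M i.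
  by apply: eq_bigr => y _; rewrite !cE.
rewrite !rmE !cmE eqxx andbT /edge_friendly !tE totM; apply/andP; split; last by lia.
apply/forallP => i; have : 0 < edge_count f i.
  by rewrite tE; have := total_countC M true; case: i => /=; lia.
by rewrite card_gt0 => /set0Pn[e]; rewrite inE => fe; apply/existsP; exists e.
Qed.

End CompleteBipartiteEdges.

(** * Constraints on row and column majorities *)

Section UpperBound.
Variables (m n h : nat) (M : 'I_m -> 'I_n -> bool).
Hypothesis nE : n = h.*2.
Hypothesis totM : total_count M true = total_count M false.

Lemma total_count_half i : total_count M i = m * h.
Proof. have := total_countC M true; rewrite /= -totM; case: i; lia. Qed.

(* A row deviates from [h] by at most [h], and the deviations cancel. *)
Lemma row_majority_le i : row_majority M i <= h * row_majority M (~~ i).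
Proof.
(* With [m * h] added on both sides, once as the total count, the claim holds row by row: a majority
   row has at least [h.+1] entries [i], a minority row pays [h]. *)
rewrite -(leq_add2l (m * h)) -{2}(total_count_half i) /row_majority big_distrr.
rewrite -{1}[m]card_ord -sum_nat_const -!big_split; apply: leq_sum => x _ /=.
have := row_countC M i x; rewrite negbK; lia.
Qed.

(** Otherwise each column has at most [m./2] entries [i], fewer than [m * h] in total. *)
Lemma col_majority_gt0 i : odd m -> 0 < h -> 0 < col_majority M i.
Proof.
move=> m_odd h_gt0; rewrite lt0n; apply/negP; rewrite sum_nat_eq0 => /forallP le.
have : total_count M i <= \sum_(y < n) m./2.
  rewrite total_countE; apply: leq_sum => y _.
  by have := le y; have := col_countC M i y; lia.
rewrite total_count_half sum_nat_const card_ord; nia.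
Qed.

End UpperBound.

(** * Cyclic filling of a matrix *)

(* For [j < N], the number of [t < s] congruent to [j] modulo [N]. *)
Definition cyclic_count (N j s : nat) : nat := (s + (N.-1 - j)) %/ N.

Lemma cyclic_count0 N j : 0 < N -> cyclic_count N j 0 = 0.
Proof. by move=> N_gt0; rewrite /cyclic_count divn_small; lia. Qed.

Lemma cyclic_countS N j s : j < N ->
  cyclic_count N j s.+1 = cyclic_count N j s + (j == s %% N).
Proof.
move=> lt_jN; rewrite /cyclic_count addSn divnS; last by lia.
rewrite addnC; congr (_ + nat_of_bool _).
have lt_sN : s %% N < N by rewrite ltn_mod; lia.
have eq_s := divn_eq s N; move: (s %% N) lt_sN eq_s => t lt_tN eq_s.
(* What remains is whether [N] divides [t + N - j], which lies strictly between 0 and [2 * N]. *)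
rewrite {1}eq_s -addnS -addnA dvdn_addr ?dvdn_mull //.
have [->|ne_jt] := eqVneq j t; first by rewrite (_ : t + _ = N) ?dvdnn //; lia.
apply/negP => /dvdnP[[|[|c]]]; nia.
Qed.

Lemma sum_cyclic_count N s : 0 < N -> \sum_(j < N) cyclic_count N j s = s.
Proof.
move=> N_gt0; elim: s => [|s IHs].
  by rewrite big1 // => j _; apply: cyclic_count0.
rewrite (eq_bigr (fun j : 'I_N => cyclic_count N j s + (j == s %% N :> nat))).
  rewrite big_split IHs /= -addn1; congr (_ + _).
  have lt_sN : s %% N < N by rewrite ltn_mod.
  rewrite (bigD1 (Ordinal lt_sN)) //= eqxx big1 // => j.
  by rewrite -val_eqE /= => /negPf ->.
by move=> j _; apply: cyclic_countS.
Qed.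

Lemma telescope_ord (g : nat -> nat) m : (forall i, i < m -> g i <= g i.+1) ->
  \sum_(i < m) (g i.+1 - g i) = g m - g 0 /\ g 0 <= g m.
Proof.
elim: m => [|m IHm] g_homo; first by rewrite big_ord0 subnn.
have [i lt_im|sum_g le_g] := IHm; first by apply: g_homo; lia.
by rewrite big_ord_recr /= sum_g; have := g_homo m (leqnn _); lia.
Qed.

Lemma sum_ord_interval a b m : b <= m -> \sum_(i < m) (a <= i < b) = b - a.
Proof.
suff H : \sum_(i < m) (a <= i < b) = minn b m - a by move/minn_idPl => bm; rewrite H bm.
elim: m => [|m IHm]; first by rewrite big_ord0; lia.
by rewrite big_ord_recr /= IHm; lia.
Qed.

(* Row [i] occupies the cells [S i, ..., S i.+1 - 1] of a strip wound cyclically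
   around the [N] columns. *)
Definition cyclic_fill (N : nat) (S : nat -> nat) (i j : nat) : bool :=
  cyclic_count N j (S i) < cyclic_count N j (S i.+1).

Section CyclicFill.
Variables (m N : nat) (S : nat -> nat).
Hypothesis N_gt0 : 0 < N.
Hypothesis S_step : forall i, i < m -> S i <= S i.+1 <= S i + N.

(** At most [N] consecutive cells meet each column at most once, so a boolean entry records the
    whole increment. *)
Lemma cyclic_count_step j i : i < m ->
  cyclic_count N j (S i) <= cyclic_count N j (S i.+1) <= (cyclic_count N j (S i)).+1.
Proof.
move=> /S_step/andP[le1 le2]; rewrite /cyclic_count leq_div2r ?leq_add2r //=.
have succE x : (x %/ N).+1 = (x + N) %/ N by rewrite divnDr // divnn N_gt0 addn1.
by rewrite succE; apply: leq_div2r; lia.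
Qed.

Lemma cyclic_fillE i j : i < m -> cyclic_fill N S i j =
  cyclic_count N j (S i.+1) - cyclic_count N j (S i) :> nat.
Proof. by move=> /(cyclic_count_step j); rewrite /cyclic_fill; lia. Qed.

Lemma cyclic_fill_row i : i < m ->
  \sum_(j < N) cyclic_fill N S i j = S i.+1 - S i.
Proof.
move=> lt_im; rewrite -[in RHS](sum_cyclic_count (S i.+1) N_gt0).
rewrite -[X in _ - X](sum_cyclic_count (S i) N_gt0) -sumnB => [|j _].
  by apply: eq_bigr => j _; apply: cyclic_fillE.
by case/andP: (cyclic_count_step j lt_im).
Qed.

Lemma cyclic_fill_col j : S 0 = 0 ->
  \sum_(i < m) cyclic_fill N S i j = cyclic_count N j (S m).
Proof.
move=> S0; pose g i := cyclic_count N j (S i).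
have [i lt_im|sum_g _] := @telescope_ord g m.
  by case/andP: (cyclic_count_step j lt_im).
rewrite (eq_bigr (fun i : 'I_m => g i.+1 - g i)) => [|i _].
  by rewrite sum_g /g S0 cyclic_count0 // subn0.
exact: cyclic_fillE.
Qed.

End CyclicFill.

(** * Prescribed row sums *)

(* Cumulative row sums: [z] rows below [h], [p] rows equal to [h.+1], then rows
   equal to [h]; the inner [minn] spreads a deficit of [p] over the first [z]
   rows with between [1] and [h] per row. *)
Definition row_profile (h z p i : nat) : nat :=
  h * i + minn (i - z) p - minn (h * minn i z) (p - (z - minn i z)).

Lemma row_profile0 h z p : row_profile h z p 0 = 0.
Proof. by rewrite /row_profile; lia. Qed.

Section RowProfile.
Variables h z p : nat.
Hypothesis z_le_p : z <= p.
Hypothesis p_le : p <= h * z.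
Local Notation S := (row_profile h z p).

Lemma row_profile_end m : z + p <= m -> S m = h * m.
Proof.
move=> le_m; rewrite /row_profile (_ : minn m z = z); last by lia.
by rewrite subnn subn0; lia.
Qed.

Lemma row_profile_ge i : h * (i - z) <= S i.
Proof. by rewrite /row_profile; case: (leqP i z) => le_iz; nia. Qed.

(** The deficit spent after [i] rows is the smaller of [h * i] and [p - (z - i)], which keeps one
    unit for each later low row; each increment is thus between 1 and [h]. *)
Lemma row_profile_low i : i < z -> S i <= S i.+1 < S i + h.
Proof.
move=> lt_iz; rewrite /row_profile.
have -> : minn i z = i by lia.
have -> : minn i.+1 z = i.+1 by lia.
have -> : i - z = 0 by lia.
have -> : i.+1 - z = 0 by lia.
nia.
Qed.

Lemma row_profile_high i : z <= i < z + p -> S i.+1 = S i + h.+1.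
Proof.
move=> /andP[le_zi lt_ip]; rewrite /row_profile.
have -> : minn i z = z by lia.
have -> : minn i.+1 z = z by lia.
have := leq_mul (leqnn h) le_zi; rewrite subnn; lia.
Qed.

Lemma row_profile_mid i : z + p <= i -> S i.+1 = S i + h.
Proof.
move=> le_i; rewrite /row_profile.
have -> : minn i z = z by lia.
have -> : minn i.+1 z = z by lia.
have le_zi : z <= i by lia.
have := leq_mul (leqnn h) le_zi; rewrite subnn; lia.
Qed.

Lemma row_profile_step i : S i <= S i.+1 <= S i + h.+1.
Proof.
have [/row_profile_low|le_zi] := ltnP i z; first by lia.
have [lt_i|le_i] := ltnP i (z + p).
  by rewrite row_profile_high ?le_zi //; lia.
by rewrite row_profile_mid //; lia.
Qed.

End RowProfile.

(** * Labelings that realize a row profile *)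

Section ProfileLabeling.
Variables (m n h z p : nat) (M : 'I_m -> 'I_n -> bool).
Hypothesis nE : n = h.*2.
Hypothesis z_le_p : z <= p.
Hypothesis p_le : p <= h * z.
Hypothesis zp_le : z + p <= m.
Local Notation S := (row_profile h z p).
Hypothesis rowM : forall x, row_count M true x = S x.+1 - S x.

Lemma profile_total : total_count M true = total_count M false.
Proof.
have totT : total_count M true = h * m.
  rewrite /total_count (eq_bigr (fun x : 'I_m => S x.+1 - S x)) => [|x _] //.
  have [i _|-> _] := @telescope_ord S m.
    by case/andP: (row_profile_step z_le_p p_le i).
  by rewrite row_profile0 row_profile_end // subn0.
have := total_countC M true; rewrite totT /=; nia.
Qed.

Lemma profile_row_majority :
  row_majority M true = p /\ row_majority M false = z.
Proof.
have rowF x : row_count M false x = n - (S x.+1 - S x).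
  by have := row_countC M true x; rewrite rowM /=; lia.
split.
  transitivity (\sum_(x < m) (z <= x < z + p)); last first.
    by rewrite sum_ord_interval //; lia.
  apply: eq_bigr => x _ /=; rewrite rowM rowF; congr nat_of_bool.
  have [/(row_profile_low z_le_p p_le)|le_zi] := ltnP x z; first by lia.
  have [lt_i|le_i] := ltnP x (z + p); first by rewrite row_profile_high ?le_zi //; lia.
  by rewrite row_profile_mid //; lia.
transitivity (\sum_(x < m) (0 <= x < z)); last first.
  by rewrite sum_ord_interval //; lia.
apply: eq_bigr => x _ /=; rewrite rowM rowF; congr nat_of_bool.
have [/(row_profile_low z_le_p p_le)|le_zi] := ltnP x z; first by lia.
have [lt_i|le_i] := ltnP x (z + p); first by rewrite row_profile_high ?le_zi //; lia.
by rewrite row_profile_mid //; lia.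
Qed.

End ProfileLabeling.

Lemma balanced_columns_labeling m n h z p :
  odd m -> n = h.*2 -> 0 < h -> z <= p -> p <= h * z -> z + p <= m ->
  exists M : 'I_m -> 'I_n -> bool,
    [/\ total_count M true = total_count M false,
        row_majority M true = p, row_majority M false = z,
        col_majority M true = h & col_majority M false = h].
Proof.
move=> m_odd nE h_gt0 z_le_p p_le zp_le; pose S := row_profile h z p.
have n_gt0 : 0 < n by lia.
have S_step i : i < m -> S i <= S i.+1 <= S i + n.
  by have := row_profile_step z_le_p p_le i; rewrite /S; lia.
have S0 : S 0 = 0 by apply: row_profile0.
have Sm : S m = h * m by apply: row_profile_end.
exists (fun x y => cyclic_fill n S x y); set M := (M in total_count M).
have rowM x : row_count M true x = S x.+1 - S x.
  rewrite -(cyclic_fill_row n_gt0 S_step (ltn_ord x)).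
  by apply: eq_bigr => y _; rewrite eqb_id.
have colM y : col_count M true y = m./2 + (y < h).
  transitivity (cyclic_count n y (S m)).
    rewrite -(cyclic_fill_col n_gt0 S_step y S0).
    by apply: eq_bigr => x _; rewrite eqb_id.
  have lt_yn := ltn_ord y; rewrite Sm /cyclic_count.
  (* The strip makes [m./2] full turns and covers [h] further cells, so exactly the first [h]
     columns reach a majority of ones. *)
  have -> : h * m + (n.-1 - y) = m./2 * n + (h + (n.-1 - y)) by nia.
  rewrite divnMDl //; congr (_ + _); case: ltnP => y_h.
    have -> : h + (n.-1 - y) = 1 * n + (h.-1 - y) by lia.
    by rewrite divnMDl // divn_small //; lia.
  by rewrite divn_small //; lia.
have colF y : col_count M false y = m./2 + (h <= y).
  by have := col_countC M true y; rewrite colM /=; lia.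
have [rT rF] := profile_row_majority nE z_le_p p_le zp_le rowM.
split=> //; first exact: profile_total rowM.
- transitivity (\sum_(y < n) (0 <= y < h)); last by rewrite sum_ord_interval //; lia.
  by apply: eq_bigr => y _ /=; rewrite colM colF; lia.
- transitivity (\sum_(y < n) (h <= y < n)); last by rewrite sum_ord_interval //; lia.
  by apply: eq_bigr => y _ /=; rewrite colM colF ltn_ord; lia.
Qed.

(* With [b = (m + 1) / 2 - h], one column gets a 1 in exactly the last [b] rows;
   the other [n - 1] columns then share [(n - 1) * (m + 1) / 2] ones. *)
Lemma single_zero_column_labeling m N h z p :
  odd m -> N.+1 = h.*2 -> 1 < h -> h <= m./2 ->
  z <= p -> p <= h * z -> z + p <= m ->
  exists M : 'I_m -> 'I_N.+1 -> bool,
    [/\ total_count M true = total_count M false,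
        row_majority M true = p, row_majority M false = z,
        col_majority M true = N & col_majority M false = 1].
Proof.
move=> m_odd nE h_gt1 h_le z_le_p p_le zp_le; pose S := row_profile h z p.
(* [T] is the cumulative sum outside the reserved column; this [b] leaves exactly [m./2.+1] full
   turns around the [N] others. *)
pose b := m./2.+1 - h; pose T i := S i - (i - (m - b)).
have N_gt0 : 0 < N by lia.
have S_ge i : i - (m - b) <= S i.
  apply: leq_trans (row_profile_ge z_le_p p_le i).
  by apply: leq_trans (leq_pmull _ (ltnW h_gt1)); rewrite /b; lia.
(* Since [z <= m./2 < m - b], the last [b] rows are not low and have a one to give up; [h.+1 <= N]
   needs [1 < h]. *)
have S_step i : i < m -> (m - b <= i) + S i <= S i.+1 <= S i + N.
  move=> lt_im; have [lt_iz|le_zi] := ltnP i z.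
    by have := row_profile_low z_le_p p_le lt_iz; rewrite -/S /b; lia.
  have [lt_i|le_i] := ltnP i (z + p).
    by have := @row_profile_high h z p z_le_p p_le i; rewrite le_zi lt_i -/S; lia.
  by have := row_profile_mid z_le_p p_le le_i; rewrite -/S; lia.
have T_step i : i < m -> T i <= T i.+1 <= T i + N.
  by move/S_step; have := S_ge i; have := S_ge i.+1; rewrite /T; lia.
have T0 : T 0 = 0 by rewrite /T /S row_profile0.
have Tm : T m = m./2.+1 * N.
  by rewrite /T /S row_profile_end // /b; nia.
pose M (x : 'I_m) (y : 'I_N.+1) := if y < N then cyclic_fill N T x y else m - b <= x.
exists M.
have rowM x : row_count M true x = S x.+1 - S x.
  have lt_xm := ltn_ord x.
  transitivity ((T x.+1 - T x) + (m - b <= x)); last first.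
    have := S_step _ lt_xm; have := S_ge x; have := S_ge x.+1; rewrite /T; lia.
  rewrite -(cyclic_fill_row N_gt0 T_step lt_xm).
  rewrite /row_count big_ord_recr /= /M /= ltnn eqb_id; congr (_ + _).
  by apply: eq_bigr => y _; rewrite ltn_ord eqb_id.
have colM y : col_count M true y = if y < N then m./2.+1 else b.
  case: ifP => y_N.
    transitivity (cyclic_count N y (T m)).
      rewrite -(cyclic_fill_col N_gt0 T_step y T0).
      by apply: eq_bigr => x _; rewrite /M y_N eqb_id.
    by rewrite Tm /cyclic_count divnMDl // divn_small; lia.
  transitivity (\sum_(x < m) (m - b <= x < m)).
    by apply: eq_bigr => x _; rewrite /M y_N eqb_id ltn_ord andbT.
  by rewrite sum_ord_interval // /b; lia.
have colF y : col_count M false y = if y < N then m./2 else m - b.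
  by have := col_countC M true y; rewrite colM /=; case: ifP => _; lia.
have [rT rF] := profile_row_majority nE z_le_p p_le zp_le rowM.
split=> //; first exact: profile_total rowM.
- transitivity (\sum_(y < N.+1) (0 <= y < N)).
    by apply: eq_bigr => y _ /=; rewrite colM colF; case: ifP => _; rewrite /b; lia.
  by rewrite sum_ord_interval //; lia.
- transitivity (\sum_(y < N.+1) (N <= y < N.+1)).
    apply: eq_bigr => y _ /=; rewrite colM colF ltn_ord.
    by case: (ltnP y N) => _; rewrite /b; lia.
  by rewrite sum_ord_interval //; lia.
Qed.

(** * Arithmetic of the extremal row difference *)

Section ExtremalValue.
Variables (m h q r : nat).
Hypothesis mE : m = q * h.+1 + r.
Hypothesis r_le : r <= h.
Hypothesis h_gt0 : 0 < h.

(** The difference [p - z] is at most [h.-1 * z] and at most [m - 2 * z]; the first bound serves for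
    [z <= q], the second beyond. *)
Lemma row_excess_le p z : p <= h * z -> z + p <= m -> p <= z + (q * h.-1 + (r - 2)).
Proof.
move=> p_le zp_le; have [le_zq|lt_qz] := leqP z q; last by nia.
have := leq_mul le_zq (leqnn h.-1); nia.
Qed.

Lemma row_excess_attained d : d <= q * h.-1 + (r - 2) ->
  exists z, z + d <= h * z /\ z + (z + d) <= m.
Proof.
move=> d_le; have [le_d|lt_d] := leqP d (q * h.-1).
  by exists q; nia.
by exists q.+1; nia.
Qed.

(** The case [q = 0] is impossible, [q = 1] forces [r = h], and from [q = 2] on the term [q * h.-1]
    suffices. *)
Lemma row_excess_ge : h.*2 < m -> h.*2 <= q * h.-1 + (r - 2) + 3.
Proof.
move=> lt_m; case: q mE => [|[|c]] mE'; nia.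
Qed.

End ExtremalValue.

(** * The index set in uniform and in case form *)

Lemma EBI_cbE m n h q r k : odd m -> n = h.*2 -> 0 < h -> n < m ->
  m = q * h.+1 + r -> r <= h ->
  (k \in EBI (complete_bipartite m n)) = (k <= q * h.-1 + (r - 2) + (n - 2)).
Proof.
move=> m_odd nE h_gt0 lt_nm mE r_le.
have mn_even : ~~ odd (m * n) by rewrite oddM nE odd_double andbF.
have mn_gt0 : 0 < m * n by rewrite muln_gt0; lia.
apply/(EBI_cbP _ mn_even mn_gt0)/idP => [[M [totM ->]]|k_le].
  have row_le i := row_excess_le mE r_le h_gt0 (row_majority_le nE totM i).
  have := row_le true; have := row_le false.
  have := row_majorityD M true; have := col_majorityD M true m_odd.
  have := col_majority_gt0 nE totM true m_odd h_gt0.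
  have := col_majority_gt0 nE totM false m_odd h_gt0.
  by rewrite /=; lia.
have [k_le'|k_gt] := leqP k (q * h.-1 + (r - 2)).
  have [z [le1 le2]] := row_excess_attained mE r_le h_gt0 k_le'.
  have [M [totM rT rF cT cF]] :=
    balanced_columns_labeling m_odd nE h_gt0 (leq_addr k z) le1 le2.
  by exists M; split=> //; rewrite rT rF cT cF; lia.
(* For [h = 1] the term [n - 2] is 0 and no such [k] exists. *)
have h_gt1 : 1 < h by lia.
have := row_excess_ge mE r_le h_gt0; rewrite -nE => /(_ lt_nm) n_le.
have k_le' : k - (n - 2) <= q * h.-1 + (r - 2) by lia.
have [z [le1 le2]] := row_excess_attained mE r_le h_gt0 k_le'.
case: n nE lt_nm {mn_even mn_gt0} k_le k_le' n_le le1 le2 => [|N] nE lt_nm; first by lia.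
move=> k_le k_le' n_le le1 le2.
have h_le : h <= m./2 by lia.
have [M [totM rT rF cT cF]] :=
  single_zero_column_labeling m_odd nE h_gt1 h_le (leq_addr _ z) le1 le2.
by exists M; split=> //; rewrite rT rF cT cF; lia.
Qed.

Theorem theorem3p1 (m n : nat) (m_odd : odd m) (n_even : ~~ odd n)
    (lt_nm : n < m) (n_ge2 : 2 <= n) :
  (n = 2 -> EBI (complete_bipartite m n) =i [pred k : nat | k == 0]) /\
  (4 <= n ->
   let q := m %/ (n %/ 2 + 1) in
   let r := m %% (n %/ 2 + 1) in
   [/\ r = 0 ->
         EBI (complete_bipartite m n) =i [pred k : nat | k <= m + n - 2 * q - 2],
       r = 1 ->
         EBI (complete_bipartite m n) =i [pred k : nat | k <= m + n - 2 * q - 3]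
     & 2 <= r ->
         EBI (complete_bipartite m n) =i [pred k : nat | k <= m + n - 2 * q - 4]]).
Proof.
have nE : n = (n %/ 2).*2 by lia.
have h_gt0 : 0 < n %/ 2 by lia.
have mE := divn_eq m (n %/ 2).+1.
have r_le : m %% (n %/ 2).+1 <= n %/ 2 by rewrite -ltnS ltn_mod.
have EBIE k := EBI_cbE k m_odd nE h_gt0 lt_nm mE r_le.
(* Here [h = 1] and [r <= 1], so all three summands of the bound vanish. *)
split=> [n2 k|_]; first by rewrite EBIE inE n2 /= in mE r_le *; lia.
rewrite addn1 /=; move: (m %/ _) (m %% _) mE r_le EBIE => q r mE r_le EBIE.
(* The bound is [m + n - 2 * q - 2 - r + (r - 2)]; truncation of [r - 2] produces the three
   cases. *)
by split=> r_val k; rewrite EBIE inE; congr (_ <= _); nia.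
Qed.
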